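(* Let $d=2$ and $k\in\mathbb N$, $k\ge1$. The $k$-th power $\mathcal I^k$ of the ideal $\mathcal I$ is generated by the set of three-directional box spline symbols $$\mathrm I_k:=\Bigl\{B^\#_{\beta,\beta,\alpha},\,B^\#_{\beta,\alpha,\beta},\,B^\#_{\alpha,\beta,\beta}\;:\;\alpha=0,1,\dots,\Bigl\lfloor\frac k2\Bigr\rfloor,\ \beta=k-\alpha\Bigr\}.$$
   Context: $\Pi^2$ denotes the ring of polynomials in $z_1,z_2$ (real coefficients), $\mathcal I=\{p\in\Pi^2:\ p(\varepsilon)=0\text{ for all }\varepsilon\in\{-1,+1\}^2\setminus\{(1,1)\}\}$, and $\mathcal I^k$ is its $k$-th ideal power, which coincides with $\{p\in\Pi^2:\ (D^{\mathbf j}p)(\varepsilon)=0\text{ for }\varepsilon\in\{-1,+1\}^2\setminus\{(1,1)\},\ |\mathbf j|<k\}$ ($D^{\mathbf j}$ being partial derivatives). For $\alpha,\beta,\gamma\in\mathbb N_0$, $B^\#_{\alpha,\beta,\gamma}(z_1,z_2)=\bigl(\frac{1+z_1}{2}\bigr)^\alpha\bigl(\frac{1+z_2}{2}\bigr)^\beta\bigl(\frac{1+z_1z_2}{2}\bigr)^\gamma$. *)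

(* Defs.v *)
From HB Require Import structures.
From mathcomp Require Import all_boot all_order all_algebra.
From mathcomp Require Import classical_sets reals.
From mathcomp Require Import mpoly.

Set Implicit Arguments.
Unset Strict Implicit.
Unset Printing Implicit Defensive.

Import GRing.Theory.
Local Open Scope ring_scope.
Local Open Scope classical_set_scope.

Section Ideals.
Variable A : comNzRingType.

Definition ideal_generated (S : set A) : set A :=
  [set p | exists (n : nat) (c g : 'I_n -> A),
     (forall i, S (g i)) /\ p = \sum_(i < n) c i * g i].

Definition ideal_power (I : set A) (k : nat) : set A :=
  ideal_generated
    [set p | exists f : 'I_k -> A,
       (forall i, I (f i)) /\ p = \prod_(i < k) f i].

End Ideals.

Section BoxSplineSymbols.
Variable R : realType.

(* The points of {-1, +1}^2 other than (1, 1). *)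
Definition punctured_signs : set {ffun 'I_2 -> R} :=
  [set e | (forall i, e i = - 1 \/ e i = 1) /\ e <> [ffun=> 1]].

Definition vanishing_ideal : set {mpoly R[2]} :=
  [set p | forall e, punctured_signs e -> p.@[e] = 0].

(* The variables z_1 and z_2 are 'X_0 and 'X_1. *)
Definition box_symbol (a b c : nat) : {mpoly R[2]} :=
  (2^-1 *: (1 + 'X_0)) ^+ a * (2^-1 *: (1 + 'X_1)) ^+ b
  * (2^-1 *: (1 + 'X_0 * 'X_1)) ^+ c.

Definition box_generators (k : nat) : set {mpoly R[2]} :=
  [set p | exists2 a : nat, (a <= k./2)%N &
     let b := (k - a)%N in
     [\/ p = box_symbol b b a, p = box_symbol b a b | p = box_symbol a b b]].

End BoxSplineSymbols.

Arguments punctured_signs : clear implicits.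
Arguments vanishing_ideal : clear implicits.
Arguments box_symbol : clear implicits.
Arguments box_generators : clear implicits.

(* Main.v *)
Require Import Defs.
From HB Require Import structures.
From mathcomp Require Import all_boot all_order all_algebra.
From mathcomp Require Import classical_sets reals.
From mathcomp Require Import mpoly.
From mathcomp Require Import zify ring.

(** Put x = (1 + z_1)/2, y = (1 + z_2)/2 and w = (1 + z_1 z_2)/2, so that the
    symbols are the monomials x^a y^b w^c. At each of the three points other
    than (1, 1) exactly two of x, y, w vanish, so x^a y^b w^c vanishes there to
    the orders a + b, a + c and b + c. Both ideals of the theorem are shown to
    be generated by the symbols of pairwise order k, those for which these
    three sums are all at least k. Everything rests on the one relation
    x + y + w = 1 + 2xy.

    - The two-factor products xy, xw, yw generate I. Modulo them the relation
      makes x, y, w into orthogonal idempotents of sum 1, so each polynomial is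
      congruent to the combination of x, y, w given by its values at the three
      points ([interpolation_mod_pairwise]). Multiplying by xy, xw or yw raises
      all three sums by at least 1, so I^k lies in the ideal generated by the
      symbols of pairwise order k ([ideal_power_sub_pairwise]).
    - Conversely, a symbol of pairwise order k and total degree at least 2k is
      a multiple of a product of k factors among xy, xw, yw. A smaller degree is
      raised by multiplying with 1 = x + y + w - 2xy, which does not decrease
      the pairwise orders ([pairwise_sub_ideal_power]).
    - Every symbol of pairwise order k is divisible by one of the box
      generators, selected by its smallest exponent
      ([pairwise_sub_box_ideal]). *)

Set Implicit Arguments.
Unset Strict Implicit.
Unset Printing Implicit Defensive.

Import GRing.Theory.
Local Open Scope ring_scope.
Local Open Scope classical_set_scope.

(** * Generated ideals and powers of ideals *)

Section GeneratedIdeals.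
Variable A : comNzRingType.
Implicit Types (S T I : set A) (p q c : A).

Lemma ideal_generated_gen S p : S p -> ideal_generated S p.
Proof.
move=> Sp; exists 1%N, (fun=> 1), (fun=> p); split=> //.
by rewrite big_ord1 mul1r.
Qed.

Lemma ideal_generated0 S : ideal_generated S 0.
Proof.
exists 0%N, (fun=> 0), (fun=> 0); split; first by case.
by rewrite big_ord0.
Qed.

Lemma ideal_generatedD S p q :
  ideal_generated S p -> ideal_generated S q -> ideal_generated S (p + q).
Proof.
move=> [m [c [g [Sg ->]]]] [n [d [h [Sh ->]]]].
exists (m + n)%N, (fun i => match split i with inl j => c j | inr j => d j end),
  (fun i => match split i with inl j => g j | inr j => h j end).
split=> [i|]; first by case: (split i).
rewrite big_split_ord /=; congr (_ + _); apply: eq_bigr => i _.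
  by rewrite -[lshift n i]/(unsplit (inl i)) unsplitK.
by rewrite -[rshift m i]/(unsplit (inr i)) unsplitK.
Qed.

Lemma ideal_generatedM S c p :
  ideal_generated S p -> ideal_generated S (c * p).
Proof.
move=> [n [d [g [Sg ->]]]]; exists n, (fun i => c * d i), g; split=> //.
by rewrite big_distrr /=; apply: eq_bigr => i _; rewrite mulrA.
Qed.

Lemma ideal_generated_ind S (P : A -> Prop) :
    P 0 -> (forall p q, P p -> P q -> P (p + q)) ->
    (forall c p, S p -> P (c * p)) ->
  forall p, ideal_generated S p -> P p.
Proof.
move=> P0 PD PM p [n [c [g [Sg ->]]]].
by apply: (big_ind P) => // i _; apply: PM.
Qed.

Lemma ideal_generated_min S T :
  S `<=` ideal_generated T -> ideal_generated S `<=` ideal_generated T.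
Proof.
move=> sST p; move: p; apply: ideal_generated_ind.
- exact: ideal_generated0.
- exact: ideal_generatedD.
- by move=> c p /sST; apply: ideal_generatedM.
Qed.

Lemma ideal_power0 I p : ideal_power I 0 p.
Proof.
rewrite -[p]mulr1; apply: ideal_generatedM; apply: ideal_generated_gen.
by exists (fun=> 1); split; [case | rewrite big_ord0].
Qed.

Lemma ideal_powerS I k p q :
  I p -> ideal_power I k q -> ideal_power I k.+1 (p * q).
Proof.
move=> Ip; move: q; apply: ideal_generated_ind => [|q r|c q [f [If ->]]].
- by rewrite mulr0; apply: ideal_generated0.
- by rewrite mulrDr; apply: ideal_generatedD.
- rewrite mulrCA; apply: ideal_generatedM; apply: ideal_generated_gen.
  exists (fun i => if unlift ord0 i is Some j then f j else p); split=> [i|].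
    by case: unliftP.
  rewrite big_ord_recl unlift_none; congr (_ * _).
  by apply: eq_bigr => i _; rewrite liftK.
Qed.

(** Multiplication is bilinear, so it is enough that products of generators
    land in the right set: the sets S m then behave like a filtration that
    dominates the powers of I. *)
Lemma ideal_power_sub I (S : nat -> set A) (k : nat) :
    S 0%N 1 -> I `<=` ideal_generated (S 1%N) ->
    (forall m p q, S 1%N p -> S m q -> S m.+1 (p * q)) ->
  ideal_power I k `<=` ideal_generated (S k).
Proof.
move=> S01 sI SM; apply: ideal_generated_min => _ [f [If ->]].
elim: k f If => [|k IHk] f If; first by rewrite big_ord0; apply: ideal_generated_gen.
rewrite big_ord_recl.
have: ideal_generated (S k) (\prod_(i < k) f (lift ord0 i)) by apply: IHk.
move: (\prod_(i < k) _) (sI _ (If ord0)) => q f0 Sq.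
move: (f ord0) f0; apply: ideal_generated_ind => [|p r|c p Sp].
- by rewrite mul0r; apply: ideal_generated0.
- by rewrite mulrDl; apply: ideal_generatedD.
rewrite -mulrA; apply: ideal_generatedM.
move: q Sq; apply: ideal_generated_ind => [|q r|d q Sq].
- by rewrite mulr0; apply: ideal_generated0.
- by rewrite mulrDr; apply: ideal_generatedD.
rewrite mulrCA; apply: ideal_generatedM; apply: ideal_generated_gen; exact: SM.
Qed.

End GeneratedIdeals.

(** * Symbols of pairwise order k *)

Lemma mpoly_ring_ind (R : comNzRingType) (n : nat) (P : {mpoly R[n]} -> Prop) :
    (forall c, P c%:MP) -> (forall i, P 'X_i) ->
    (forall p q, P p -> P q -> P (p + q)) ->
    (forall p q, P p -> P q -> P (p * q)) ->
  forall p, P p.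
Proof.
move=> PC PX PD PM p; rewrite [p]mpolyE.
have P1 : P 1 by rewrite -mpolyC1.
apply: (big_ind P) => // [|m _]; first by rewrite -mpolyC0.
rewrite -mul_mpolyC; apply: (PM) => //.
rewrite mpolyXE_id; apply: (big_ind P) => // i _.
by elim: (m i) => [|e IHe]; [rewrite expr0 | rewrite exprS; apply: PM].
Qed.

Section BoxSymbols.
Variable R : realType.
Implicit Types (a b c k : nat).

Local Notation B := (box_symbol R).
Local Notation x := (B 1 0 0).
Local Notation y := (B 0 1 0).
Local Notation w := (B 0 0 1).

Definition pairwise_symbols k : set {mpoly R[2]} :=
  [set p | exists a b c,
     [/\ (k <= a + b)%N, (k <= a + c)%N, (k <= b + c)%N & p = B a b c]].

Lemma box_symbolM a b c a' b' c' :
  B a b c * B a' b' c' = B (a + a') (b + b') (c + c').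
Proof. by rewrite /box_symbol !exprD; ring. Qed.

Lemma box_symbol0 : B 0 0 0 = 1.
Proof. by rewrite /box_symbol !expr0 !mulr1. Qed.

Lemma box_xE : x = 2^-1 *: (1 + 'X_0).
Proof. by rewrite /box_symbol !expr0 !mulr1. Qed.

Lemma box_yE : y = 2^-1 *: (1 + 'X_1).
Proof. by rewrite /box_symbol !expr0 mulr1 mul1r. Qed.

Lemma box_wE : w = 2^-1 *: (1 + 'X_0 * 'X_1).
Proof. by rewrite /box_symbol !expr0 !mul1r. Qed.

Lemma mpoly_half_add (p : {mpoly R[2]}) : 2 * (2^-1 *: p) = p.
Proof.
by rewrite mulr_natl -scaler_nat scalerA mulfV ?scale1r // Num.Theory.pnatr_eq0.
Qed.

Lemma mpolyX0E : 'X_0 = 2 * x - 1 :> {mpoly R[2]}.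
Proof. by rewrite box_xE mpoly_half_add; ring. Qed.

Lemma mpolyX1E : 'X_1 = 2 * y - 1 :> {mpoly R[2]}.
Proof. by rewrite box_yE mpoly_half_add; ring. Qed.

Lemma box_w_relation : w = 1 - x - y + 2 * x * y.
Proof.
rewrite box_wE mpolyX0E mpolyX1E.
rewrite [X in _ *: X](_ : _ = 2 * (1 - x - y + 2 * x * y)); last by ring.
by rewrite scalerAr mpoly_half_add.
Qed.

Lemma box_generators_pairwise k : box_generators R k `<=` pairwise_symbols k.
Proof.
move=> p [a ak] /= [] ->.
- by exists (k - a)%N, (k - a)%N, a; split=> //; lia.
- by exists (k - a)%N, a, (k - a)%N; split=> //; lia.
- by exists a, (k - a)%N, (k - a)%N; split=> //; lia.
Qed.

Lemma box_symbol_dvd (S : set {mpoly R[2]}) a b c a' b' c' :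
    (a' <= a)%N -> (b' <= b)%N -> (c' <= c)%N -> S (B a' b' c') ->
  ideal_generated S (B a b c).
Proof.
move=> ha hb hc SB; rewrite -(subnK ha) -(subnK hb) -(subnK hc) -box_symbolM.
by apply: ideal_generatedM; apply: ideal_generated_gen.
Qed.

(** If m is the smallest of the three exponents, the other two are at least
    k - m, so the generator with alpha = m divides when m <= k/2. When m is
    larger all exponents are at least k - k/2, and alpha = k/2 works. *)
Lemma pairwise_sub_box_ideal k :
  pairwise_symbols k `<=` ideal_generated (box_generators R k).
Proof.
move=> _ [a [b [c [ab ac bc ->]]]].
pose al := minn (minn a (minn b c)) k./2.
have al_k : (al <= k./2)%N by rewrite /al; lia.
have [/andP[ca cb]|nc] := boolP ((c <= a) && (c <= b))%N.
- apply: (@box_symbol_dvd _ _ _ _ (k - al) (k - al) al).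
  + by rewrite /al; lia.
  + by rewrite /al; lia.
  + by rewrite /al; lia.
  + by exists al => //; apply: Or31.
have [/andP[ba bc']|nb] := boolP ((b <= a) && (b <= c))%N.
- apply: (@box_symbol_dvd _ _ _ _ (k - al) al (k - al)).
  + by rewrite /al; lia.
  + by rewrite /al; lia.
  + by rewrite /al; lia.
  + by exists al => //; apply: Or32.
apply: (@box_symbol_dvd _ _ _ _ al (k - al) (k - al)).
- by rewrite /al; lia.
- by rewrite /al; lia.
- by rewrite /al; lia.
- by exists al => //; apply: Or33.
Qed.

(** * The vanishing ideal *)

Definition sign_point (s t : R) : {ffun 'I_2 -> R} :=
  [ffun i => if i == 0 then s else t].

Lemma meval_mpolyX0 s t : ('X_0 : {mpoly R[2]}).@[sign_point s t] = s.
Proof. by rewrite mevalXU ffunE. Qed.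

Lemma meval_mpolyX1 s t : ('X_1 : {mpoly R[2]}).@[sign_point s t] = t.
Proof. by rewrite mevalXU ffunE. Qed.

Lemma sign_point_punctured s t :
    s = -1 \/ s = 1 -> t = -1 \/ t = 1 -> s = -1 \/ t = -1 ->
  punctured_signs R (sign_point s t).
Proof.
move=> hs ht hst; split=> [i|e1]; first by rewrite ffunE; case: ifP.
have neq : (-1 : R) <> 1.
  by apply/eqP; rewrite eqr_oppLR -subr_eq0 opprK -mulr2n Num.Theory.pnatr_eq0.
case: hst => hst.
  by move: (congr1 (fun f : 'I_2 -> R => f 0) e1); rewrite !ffunE /= hst.
by move: (congr1 (fun f : 'I_2 -> R => f 1) e1); rewrite !ffunE /= hst.
Qed.

Lemma punctured_signs_cases e : punctured_signs R e ->
  [\/ e = sign_point 1 (-1), e = sign_point (-1) 1 | e = sign_point (-1) (-1)].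
Proof.
move=> [sgn_e e1].
have eE : e = sign_point (e 0) (e 1).
  apply/ffunP => i; rewrite ffunE; case: ifP => [/eqP -> //|].
  by case: i => [[|[|]]] //= lti _; congr (e _); apply: val_inj.
move: e1; rewrite eE; case: (sgn_e 0) => ->; case: (sgn_e 1) => ->.
- by move=> _; apply: Or33.
- by move=> _; apply: Or32.
- by move=> _; apply: Or31.
- by case; apply: boolp.funext => i; rewrite !ffunE; case: ifP.
Qed.

Lemma pairwise1_gen a b c :
    (1 <= a + b)%N -> (1 <= a + c)%N -> (1 <= b + c)%N ->
  ideal_generated (pairwise_symbols 1) (B a b c).
Proof. by move=> ? ? ?; apply: ideal_generated_gen; exists a, b, c. Qed.

(** Modulo xy, xw and yw the relation gives x^2 = x, y^2 = y, w^2 = w and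
    x + y + w = 1. The congruence below thus holds for constants and variables
    and is preserved by sums and products. *)
Lemma interpolation_mod_pairwise (p : {mpoly R[2]}) :
  ideal_generated (pairwise_symbols 1)
    (p - ((p.@[sign_point 1 (-1)])%:MP * x + (p.@[sign_point (-1) 1])%:MP * y
          + (p.@[sign_point (-1) (-1)])%:MP * w)).
Proof.
have Jxy : ideal_generated (pairwise_symbols 1) (x * y).
  by rewrite box_symbolM; apply: pairwise1_gen.
have Jxw : ideal_generated (pairwise_symbols 1) (x * w).
  by rewrite box_symbolM; apply: pairwise1_gen.
have Jyw : ideal_generated (pairwise_symbols 1) (y * w).
  by rewrite box_symbolM; apply: pairwise1_gen.
elim/mpoly_ring_ind: p => [c|i|p q Jp Jq|p q].
- rewrite !mevalC box_w_relation.
  rewrite [X in ideal_generated _ X](_ : _ = - 2 * c%:MP * (x * y)); last by ring.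
  exact: ideal_generatedM.
- have [->|->] : i = 0 \/ i = 1.
  + by case: i => [[|[|]]] // lti; [left | right]; apply: val_inj.
  + rewrite !meval_mpolyX0 mpolyCN mpolyC1 box_w_relation mpolyX0E.
    rewrite [X in ideal_generated _ X](_ : _ = 2 * (x * y)); last by ring.
    exact: ideal_generatedM.
  + rewrite !meval_mpolyX1 mpolyCN mpolyC1 box_w_relation mpolyX1E.
    rewrite [X in ideal_generated _ X](_ : _ = 2 * (x * y)); last by ring.
    exact: ideal_generatedM.
- have := ideal_generatedD Jp Jq; congr ideal_generated.
  by rewrite !mevalD !mpolyCD; ring.
rewrite !mevalM !mpolyCM.
move: (p.@[_])%:MP (p.@[_])%:MP (p.@[_])%:MP => p3 p2 p1.
move: (q.@[_])%:MP (q.@[_])%:MP (q.@[_])%:MP => q3 q2 q1.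
set P := p1 * x + _ + _; set Q := q1 * x + _ + _ => Jp Jq.
(* The last three terms are P * Q minus the combination with coefficients
   p1 q1, p2 q2, p3 q3, using x^2 - x = x (2xy - y - w) and its analogues. *)
rewrite [X in ideal_generated _ X](_ : _ =
    q * (p - P) + P * (q - Q)
    + (p1 * q1 * (2 * x - 1) + p2 * q2 * (2 * y - 1) + 2 * p3 * q3 * w
       + p1 * q2 + p2 * q1) * (x * y)
    + (p1 * q3 + p3 * q1 - p1 * q1 - p3 * q3) * (x * w)
    + (p2 * q3 + p3 * q2 - p2 * q2 - p3 * q3) * (y * w)).
  by do 4?apply: ideal_generatedD; apply: ideal_generatedM.
by rewrite /P /Q box_w_relation; ring.
Qed.

Lemma vanishing_ideal_sub_pairwise :
  vanishing_ideal R `<=` ideal_generated (pairwise_symbols 1).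
Proof.
move=> p p0; have := interpolation_mod_pairwise p.
rewrite !p0 ?mpolyC0 ?mul0r ?addr0 ?subr0 //.
- by apply: sign_point_punctured; auto.
- by apply: sign_point_punctured; auto.
- by apply: sign_point_punctured; auto.
Qed.

Lemma pairwise1_vanishing : pairwise_symbols 1 `<=` vanishing_ideal R.
Proof.
move=> _ [a [b [c [ab ac bc ->]]]] e /punctured_signs_cases.
rewrite /box_symbol !mevalM !rmorphXn /=; case=> ->; rewrite !mevalZ !mevalD !mevalM;
  rewrite meval_mpolyX0 meval_mpolyX1 meval1.
- rewrite mul1r subrr mulr0 !expr0n -mulrA -natrM mulnb.
  by case: b c {ab ac} bc => [|b] [|c] //= _; rewrite mulr0.
- rewrite mulr1 subrr mulr0 !expr0n mulrAC -natrM mulnb.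
  by case: a c {ab bc} ac => [|a] [|c] //= _; rewrite mul0r.
- rewrite subrr mulr0 !expr0n -natrM mulnb.
  by case: a b {ac bc} ab => [|a] [|b] //= _; rewrite mul0r.
Qed.

(** * Powers of the vanishing ideal *)

Lemma ideal_power_sub_pairwise k :
  ideal_power (vanishing_ideal R) k `<=` ideal_generated (pairwise_symbols k).
Proof.
apply: ideal_power_sub; first by exists 0%N, 0%N, 0%N; rewrite box_symbol0.
  exact: vanishing_ideal_sub_pairwise.
move=> m _ _ [a [b [c [ab ac bc ->]]]] [a' [b' [c' [ab' ac' bc' ->]]]].
by exists (a + a')%N, (b + b')%N, (c + c')%N; rewrite box_symbolM; split=> //; lia.
Qed.

Lemma box_symbol_peel k a b c a' b' c' :
    (1 <= a' + b')%N -> (1 <= a' + c')%N -> (1 <= b' + c')%N ->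
    (a' <= a)%N -> (b' <= b)%N -> (c' <= c)%N ->
    ideal_power (vanishing_ideal R) k (B (a - a') (b - b') (c - c')) ->
  ideal_power (vanishing_ideal R) k.+1 (B a b c).
Proof.
move=> ab ac bc ha hb hc Ik.
rewrite -(subnKC ha) -(subnKC hb) -(subnKC hc) -box_symbolM.
by apply: ideal_powerS Ik; apply: pairwise1_vanishing; exists a', b', c'.
Qed.

(** Splitting off the two variables with the largest exponents lowers each
    pairwise sum by 1, except the sum of these two exponents, which drops by 2.
    That sum is at least two thirds of the degree, hence exceeds k if k > 0, and
    the drop leaves it no smaller than k - 1. *)
Lemma high_degree_sub_ideal_power k a b c :
    (k <= a + b)%N -> (k <= a + c)%N -> (k <= b + c)%N ->
    (k.*2 <= a + b + c)%N ->
  ideal_power (vanishing_ideal R) k (B a b c).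
Proof.
elim: k a b c => [|k IHk] a b c ab ac bc abc; first exact: ideal_power0.
have [/andP[ca cb]|nc] := boolP ((c <= a) && (c <= b))%N.
  by apply: (@box_symbol_peel _ _ _ _ 1 1 0) => //; try lia; apply: IHk; lia.
have [/andP[ba bc']|nb] := boolP ((b <= a) && (b <= c))%N.
  by apply: (@box_symbol_peel _ _ _ _ 1 0 1) => //; try lia; apply: IHk; lia.
by apply: (@box_symbol_peel _ _ _ _ 0 1 1) => //; try lia; apply: IHk; lia.
Qed.

(** Multiplying a symbol by 1 = x + y + w - 2xy writes it as a combination of
    symbols of larger degree whose pairwise sums are no smaller. Repeating this
    reaches degree 2k. *)
Lemma pairwise_sub_ideal_power k :
  pairwise_symbols k `<=` ideal_power (vanishing_ideal R) k.
Proof.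
move=> _ [a [b [c [ab ac bc ->]]]].
(* n bounds the missing degree. *)
have [n abcn] : exists n, (k.*2 <= a + b + c + n)%N by exists k.*2; lia.
elim: n a b c ab ac bc abcn => [|n IHn] a b c ab ac bc abcn.
  by apply: high_degree_sub_ideal_power => //; lia.
have -> : B a b c = B a b c * x + B a b c * y + B a b c * w
                     + - 2 * (B a b c * B 1 1 0).
  by rewrite box_w_relation -[B 1 1 0](box_symbolM 1 0 0 0 1 0); ring.
rewrite !box_symbolM; do 3?apply: ideal_generatedD; last apply: ideal_generatedM.
all: by apply: IHn; lia.
Qed.

End BoxSymbols.

Theorem theorem3p2 (R : realType) (k : nat) (hk : (1 <= k)%N) :
  ideal_power (vanishing_ideal R) k = ideal_generated (box_generators R k).
Proof.
rewrite eqEsubset; split.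
- apply: (subset_trans (@ideal_power_sub_pairwise R k)).
  exact: ideal_generated_min (@pairwise_sub_box_ideal R k).
- apply: ideal_generated_min => p /box_generators_pairwise.
  exact: pairwise_sub_ideal_power.
Qed.
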